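(* Let $X,Y$ be locally compact Hausdorff spaces and let $G\colon X\times Y\to[0,+\infty]$ be a lower semicontinuous kernel. Suppose $1<q<+\infty$ and $\sigma\in\mathcal{M}^+(X)$. Then the following statements are equivalent: (1) There exists a positive constant $C$ such that $\|\mathbf{G}\nu\|_{L^{q,\infty}(X,\sigma)}\le C\,\|\nu\|$ for all $\nu\in\mathcal{M}^+(Y)$. (2) $\sup_{y\in Y}\|G(\cdot,y)\|_{L^{q,\infty}(X,\sigma)}<+\infty$. (3) There exists a positive constant $C$ such that, for all measurable sets $E\subset X$, $$\sup_{y\in Y}\mathbf{G}^*\sigma_E(y)\le C\,\sigma(E)^{\frac1{q'}},\qquad \tfrac1q+\tfrac1{q'}=1.$$
   Context: $\mathcal{M}^+(X)$ denotes the nonnegative, locally finite Borel (Radon) measures on $X$ (similarly for $Y$); $\|\nu\|=\nu(Y)$ for $\nu\in\mathcal{M}^+(Y)$. $\mathbf{G}\nu(x)=\int_Y G(x,y)\,d\nu(y)$. $\sigma_E$ is the restriction of $\sigma$ to $E$, and $\mathbf{G}^*\sigma_E(y)=\int_E G(x,y)\,d\sigma(x)$. $\|f\|_{L^{q,\infty}(X,\sigma)}=\sup_{t>0}t\,\sigma(\{|f|>t\})^{1/q}$. *)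

(* Defs.v *)
From HB Require Import structures.
From mathcomp Require Export all_boot all_order all_algebra.
From mathcomp Require Export all_classical all_reals all_analysis.

#[export] Set Implicit Arguments.
#[export] Unset Strict Implicit.
#[export] Unset Printing Implicit Defensive.

Export Order.TTheory GRing.Theory Num.Theory.
Export numFieldNormedType.Exports.

Local Open Scope classical_set_scope.
Local Open Scope ring_scope.
Local Open Scope ereal_scope.

(* A copy of T carrying the Borel sigma-algebra of the topology of T. *)
Notation borelType T := (g_sigma_algebraType (@open T)).

(* [radon_measure mu] is membership of mu in M^+(T). On a locally compact
   Hausdorff space, the locally finite Borel measures with these two regularity
   properties are exactly those representing the positive linear functionals
   on C_c(T). *)
Definition locally_finite_measure (R : realType) (T : ptopologicalType)
    (mu : {measure set (borelType T) -> \bar R}) : Prop :=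
  forall x : T, exists2 U : set T, open_nbhs x U & mu U < +oo.

Definition outer_regular_measure (R : realType) (T : ptopologicalType)
    (mu : {measure set (borelType T) -> \bar R}) : Prop :=
  forall A : set (borelType T), measurable A ->
    mu A = ereal_inf [set mu U | U in [set U : set T | open U /\ A `<=` U]].

Definition inner_regular_on_open (R : realType) (T : ptopologicalType)
    (mu : {measure set (borelType T) -> \bar R}) : Prop :=
  forall U : set T, open U ->
    mu U = ereal_sup [set mu K | K in [set K : set T | compact K /\ K `<=` U]].

Definition radon_measure (R : realType) (T : ptopologicalType)
    (mu : {measure set (borelType T) -> \bar R}) : Prop :=
  [/\ locally_finite_measure mu, outer_regular_measure mu &
      inner_regular_on_open mu].

(* The quasi-norm of L^{q,oo}(T, mu), for 0 < q < +oo; for an infinite value of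
   mu the power is [+oo `^ q^-1 = +oo]. *)
Definition weak_Lnorm (d : measure_display) (T : measurableType d)
    (R : realType) (mu : {measure set T -> \bar R}) (q : R)
    (f : T -> \bar R) : \bar R :=
  ereal_sup [set t%:E * mu [set x | t%:E < `|f x|] `^ (q^-1)
            | t in [set t : R | (0 < t)%R]].

Definition potential (R : realType) (X Y : ptopologicalType)
    (G : X -> Y -> \bar R) (nu : {measure set (borelType Y) -> \bar R})
    (x : X) : \bar R :=
  \int[nu]_(y in [set: borelType Y]) G x y.

Definition adjoint_potential (R : realType) (X Y : ptopologicalType)
    (G : X -> Y -> \bar R) (sigma : {measure set (borelType X) -> \bar R})
    (E : set (borelType X)) (y : Y) : \bar R :=
  \int[sigma]_(x in E) G x y.

(* Main.v *)
(** The implication (1) => (2) tests (1) on Dirac masses.  For (2) => (3), the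
    dyadic bound [f <= s + sum_k s 2^k 1_{f > s 2^k}] is integrated over [E] with
    [s = sigma(E)^(-1/q)].  For (3) => (1), let [K] be a compact subset of the
    open set [{G nu > t}].  Neither [sigma] nor the spaces are assumed
    sigma-finite or second countable, so Tonelli's theorem is not available.
    Instead, near each point of [K] the kernel dominates a function of [y] alone
    whose [nu]-integral exceeds [t]; splitting [K] into finitely many Borel
    pieces yields [H <= G* sigma_K] with [t sigma(K) <= int H dnu], hence
    [t sigma(K) <= C sigma(K)^(1/q') nu(Y)].  Inner regularity of [sigma] on open
    sets then bounds [sigma {G nu > t}]. *)

Require Import Defs.
From mathcomp Require Import measurable_realfun ring lra.

Local Open Scope classical_set_scope.
Local Open Scope ring_scope.
Local Open Scope ereal_scope.

(** * Compact sets, Borel measurability and local finiteness *)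

(** The open sets satisfying [P] cover [K]; a finite subcover has a union satisfying [P], which then
    passes down to [K]. *)
Lemma compact_ind (T : ptopologicalType) (K : set T) (P : set T -> Prop) :
  compact K -> P set0 ->
  (forall A B, P A -> P B -> P (A `|` B)) ->
  (forall A B, B `<=` A -> P A -> P B) ->
  (forall x, K x -> exists2 U, open_nbhs x U & P U) -> P K.
Proof.
rewrite compact_cover => cK P0 PU Psub Ploc.
have [||D DP KD] := cK (set T) [set U | open U /\ P U] id; first by move=> U [].
  by move=> x /Ploc[U [oU Ux] PU']; exists U.
apply: Psub KD _; rewrite /cover bigcup_fset big_seq.
by apply: big_ind => // U /DP/set_mem[].
Qed.

Section borel.
Context (R : realType) (T : ptopologicalType).

Lemma open_borel_measurable (U : set T) :
  open U -> measurable (U : set (borelType T)).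
Proof. exact: sub_gen_smallest. Qed.

Lemma compact_borel_measurable (K : set T) : hausdorff_space T ->
  compact K -> measurable (K : set (borelType T)).
Proof.
move=> hT /(compact_closed hT)/closed_openC/open_borel_measurable.
by move=> /measurableC; rewrite setCK.
Qed.

Lemma lsc_borel_measurable (f : T -> \bar R) : lower_semicontinuous f ->
  measurable_fun [set: borelType T] (f : borelType T -> \bar R).
Proof.
move=> /lower_semicontinuousP lf.
apply: (measurability _ (ErealGenOInfty.measurableE R)) => _ [_ [a ->] <-].
rewrite setTI preimage_itvoy; exact: open_borel_measurable.
Qed.

Lemma locally_finite_compact (mu : {measure set (borelType T) -> \bar R})
    (K : set T) : locally_finite_measure mu -> hausdorff_space T ->
  compact K -> mu K < +oo.
Proof.
move=> lf hT cK.
(* Asking for an open superset makes the property pass to arbitrary subsets, measurable or not, as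
   [compact_ind] demands. *)
pose P (A : set T) := exists2 U : set T, open U /\ A `<=` U & mu U < +oo.
suff [U [oU KU] muU] : P K.
  apply: le_lt_trans muU; apply: le_measure => //; rewrite inE.
    exact: compact_borel_measurable.
  exact: open_borel_measurable.
apply: compact_ind cK _ _ _ _.
- by exists set0; [split => //; exact: open0|rewrite measure0].
- move=> A B [U [oU AU] muU] [V [oV BV] muV]; exists (U `|` V).
    by split; [exact: openU|exact: setUSS].
  apply: le_lt_trans (lte_add_pinfty muU muV).
  by apply: measureU2; exact: open_borel_measurable.
- by move=> A B BA [U [oU AU] muU]; exists U => //; split => // x /BA /AU.
- move=> x _; have [U [oU Ux] muU] := lf x; exists U; [by split|].
  by exists U; [split|].
Qed.

End borel.

(** * Semicontinuity of the slices of the kernel *)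

Section slices.
Context (R : realType) (X Y : ptopologicalType) (G : X -> Y -> \bar R).
Hypothesis G_lsc : lower_semicontinuous (fun z : X * Y => G z.1 z.2).

Lemma lsc_fst y : lower_semicontinuous (G^~ y).
Proof.
move=> x a /(G_lsc (x := (x, y)))[V [[A B]/= [xA yB] AB] VG].
exists A => // x' Ax'; apply: (VG (x', y)); apply: AB; split => //.
exact: nbhs_singleton.
Qed.

Lemma lsc_snd x : lower_semicontinuous (G x).
Proof.
move=> y a /(G_lsc (x := (x, y)))[V [[A B]/= [xA yB] AB] VG].
exists B => // y' By'; apply: (VG (x, y')); apply: AB; split => //.
exact: nbhs_singleton.
Qed.

(** A tube lemma: each [y] in [L] gives a product neighbourhood on which the strict bound persists,
    and compactness of [L] leaves a single neighbourhood of [x]. *)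
Lemma lsc_tube x a (L : set Y) : compact L -> (forall y, L y -> a%:E < G x y) ->
  \forall x' \near x, forall y, L y -> a%:E < G x' y.
Proof.
move=> /compact_near_coveringP cL aG.
apply: (cL X (nbhs x) (fun x' y => a%:E < G x' y)) => y Ly.
have [V [[A B]/= [xA yB] AB] VG] := G_lsc (x := (x, y)) (aG y Ly).
by exists (B, A) => // -[y' x'] [/= By' Ax']; apply: (VG (x', y')); exact: AB.
Qed.

End slices.

(** * Finite layer sums with equally spaced heights *)

(** The invariant that the sum is at most [N%:R * d] is carried along: when the top layer is
    present, its height alone dominates the whole sum. Hence the layers need not be nested. *)
Lemma layers_le (R : realType) (d : R) (g : \bar R) (b : nat -> bool) N :
  (0 <= d)%R -> 0 <= g -> (forall i, b i -> (i.+1%:R * d)%:E < g) ->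
  (d * \sum_(i < N) (b i)%:R)%:E <= g.
Proof.
move=> d0 g0 bg.
suff : ((d * \sum_(i < N) (b i)%:R)%:E <= g) &&
       (d * \sum_(i < N) (b i)%:R <= N%:R * d)%R by case/andP.
elim: N => [|N /andP[IHg IHN]]; first by rewrite big_ord0 mulr0 mul0r g0 lexx.
have SN : (d * \sum_(i < N.+1) (b i)%:R <= N.+1%:R * d)%R.
  rewrite big_ord_recr/= mulrDr -natr1 mulrDl mul1r lerD//.
  by case: (b N); rewrite ?mulr1 ?mulr0.
rewrite SN andbT; have [bN|] := boolP (b N).
  by apply: (le_trans _ (ltW (bg N bN))); rewrite lee_fin.
by rewrite big_ord_recr/= => /negbTE ->; rewrite addr0.
Qed.

(** Either the sum has already come within [d] of [r], or all layers so far are present and the sum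
    is exactly [N%:R * d], which is at least [r]. *)
Lemma layers_ge (R : realType) (d r : R) (b : nat -> bool) N :
  (0 <= d)%R -> (forall i, (i.+1%:R * d < r)%R -> b i) ->
  (r <= N%:R * d)%R -> (r - d <= d * \sum_(i < N) (b i)%:R)%R.
Proof.
move=> d0 br rN.
suff [//|->] : (r - d <= d * \sum_(i < N) (b i)%:R)%R \/
  (d * \sum_(i < N) (b i)%:R = N%:R * d)%R by lra.
elim: N {rN} => [|N]; first by right; rewrite big_ord0 mulr0 mul0r.
rewrite big_ord_recr/= mulrDr -natr1 mulrDl mul1r.
have [/br|Nr] := ltP (N.+1%:R * d)%R r.
  by move=> ->; rewrite mulr1 => -[?|->]; [left|right]; lra.
have bN : (0 <= d * (b N)%:R)%R by rewrite mulr_ge0.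
by move: Nr; rewrite -natr1 mulrDl mul1r => Nr [?|E]; left; rewrite ?E; lra.
Qed.

Section layers.
Context (d : measure_display) (T : measurableType d) (R : realType).
Variables (c : R) (A : nat -> set T) (N : nat).
Hypotheses (c0 : (0 <= c)%R) (mA : forall i, measurable (A i)).

Lemma measurable_layers :
  measurable_fun setT (fun y => (c * \sum_(i < N) (y \in A i)%:R)%:E).
Proof.
apply/measurable_EFinP; apply: measurable_funM => //.
by apply: measurable_sum => i; exact: measurable_indic.
Qed.

Lemma integral_layers (mu : {measure set T -> \bar R}) :
  \int[mu]_y (c * \sum_(i < N) (y \in A i)%:R)%:E =
    c%:E * \sum_(i < N) mu (A i).
Proof.
have mI i : measurable_fun setT (fun y => ((y \in A i)%:R : R)%:E).
  by apply/measurable_EFinP; exact: measurable_indic.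
under eq_integral do rewrite EFinM -sumEFin.
rewrite ge0_integralZl//; last first.
- by move=> y _; apply: sume_ge0 => i _; rewrite lee_fin.
- exact: emeasurable_sum.
rewrite ge0_integral_sum//; congr (_ * _); apply: eq_bigr => i _.
by rewrite (integral_indic mu measurableT (mA i)) setIT.
Qed.

End layers.

(** * Approximating the integral of a semicontinuous function by layers over compact sets *)

Section minorant.
Context (R : realType) (T : ptopologicalType).
Variable nu : {measure set (borelType T) -> \bar R}.
Hypotheses (nu_fin : nu setT < +oo) (nu_inner : inner_regular_on_open nu).
Hypothesis hT : hausdorff_space T.
Import HBNNSimple.

(** A bounded simple function below [g] is discretized into layers over the open superlevel sets of
    [g], and these are shrunk to compact sets by inner regularity. Compactness of the layers is what
    later lets [lsc_tube] apply. *)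
Lemma lsc_integral_layers (g : T -> \bar R) (t : R) :
  lower_semicontinuous g -> (forall y, 0 <= g y) ->
  t%:E < \int[nu]_(y in [set: borelType T]) g y ->
  exists d N (L : nat -> set T), [/\ (0 < d)%R, forall i, compact (L i),
    forall i y, L i y -> (i.+1%:R * d)%:E < g y &
    t%:E < \int[nu]_(y in [set: borelType T])
      (d * \sum_(i < N) (y \in L i)%:R)%:E].
Proof.
move=> g_lsc g0; rewrite ge0_integralTE// => /ereal_sup_gt[_ [f /= fg <-]].
rewrite -integralT_nnsfun => tf.
have nuE A : measurable A -> nu A = (fine (nu A))%:E.
  by move=> mA; rewrite fineK//; exact: (lty_fin_num_fun nu_fin).
set V := fine (nu setT).
have V0 : (0 <= V)%R by exact: fine_ge0.
have [M M0 fM] : exists2 M : R, (0 < M)%R & forall y, (f y <= M)%R.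
  have [M [_ fM]] := simple_bounded f; exists (`|M| + 1)%R.
    by rewrite ltr_wpDl.
  move=> y; apply: le_trans (ler_norm _) _; apply: (fM (`|M| + 1)%R) => //.
  by rewrite ltr_pwDr// ler_norm.
have mf : measurable_fun [set: borelType T] (EFin \o f).
  exact/measurable_EFinP.
have intf : \int[nu]_(y in [set: borelType T]) (f y)%:E \is a fin_num.
  rewrite ge0_fin_numE; last by apply: integral_ge0 => y _; rewrite lee_fin.
  apply: (@le_lt_trans _ _ (\int[nu]_(y in [set: borelType T]) cst M%:E y)).
    by apply: ge0_le_integral => // y _ /=; rewrite lee_fin.
  by rewrite integral_cst// nuE// ltry.
set F := \int[nu]_(y in _) _ in tf intf.
(* The slack between the integral of [f] and [t] is split in two: one [e] for discretizing [f], one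
   for shrinking the level sets. The choice of [N] makes the first cost [d * V] strictly less than
   [e], while [N] steps of size [d] reach exactly the bound [M]. *)
pose e := ((fine F - t) / 2)%R.
have e0 : (0 < e)%R.
  by rewrite divr_gt0// subr_gt0 -lte_fin fineK.
pose N := (Num.truncn (M * (V + 1) / e)).+1.
pose d := (M / N%:R)%R.
have d0 : (0 < d)%R by rewrite divr_gt0.
have NdM : (N%:R * d = M)%R by rewrite mulrC divfK// pnatr_eq0.
have dV : (d * V < e)%R.
  have : (d * (V + 1) < e)%R.
    have := truncnS_gt (M * (V + 1) / e)%R.
    by rewrite -/N ltr_pdivrMr// [(N%:R * e)%R]mulrC /d
      [(M / _ * _)%R]mulrAC ltr_pdivrMr.
  lra.
clearbody d N.
pose U i := [set y | (i.+1%:R * d)%:E < g y].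
have oU i : open (U i) by move/lower_semicontinuousP : g_lsc; exact.
have mU i : measurable (U i : set (borelType T)).
  exact: open_borel_measurable.
(* Each of the [N] layers has weight [d] and may lose measure [e / M], so the total loss is
   [d * N * e / M = e]. *)
have [L LP] : {L : nat -> set T & forall i,
    [/\ compact (L i), L i `<=` U i & (fine (nu (U i)) - e / M)%:E < nu (L i)]}.
  apply: (@choice _ _ (fun i K => [/\ compact K, K `<=` U i &
    (fine (nu (U i)) - e / M)%:E < nu K])) => i.
  have [||_ [K [cK KU] <-]] := @ub_ereal_sup_adherent _
    [set nu K | K in [set K : set T | compact K /\ K `<=` U i]] (e / M).
  - by rewrite divr_gt0.
  - by rewrite -nu_inner// nuE.
  by rewrite -nu_inner// nuE// -EFinB => KP; exists K.
have mL i : measurable (L i : set (borelType T)).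
  by have [cL _ _] := LP i; exact: compact_borel_measurable.
exists d, N, L; split => //.
- by move=> i; have [] := LP i.
- by move=> i y Liy; have [_ /(_ y Liy)] := LP i.
rewrite integral_layers ?(ltW d0)//.
(* Pointwise, [f] is at most the layer sum plus [d]; integrating the constant [d] gives [d * V]. *)
have FU : (fine F <= d * \sum_(i < N) fine (nu (U i)) + d * V)%R.
  rewrite -lee_fin fineK// EFinD !EFinM -sumEFin.
  under eq_bigr do rewrite -nuE//.
  rewrite -nuE// -integral_layers ?(ltW d0)// -integral_cst//.
  rewrite -ge0_integralD//; first last.
  - by move=> y _; rewrite lee_fin ltW.
  - exact: measurable_layers.
  - by move=> y _; rewrite lee_fin mulr_ge0 ?sumr_ge0 ?ltW//.
  apply: ge0_le_integral => //.
  - by move=> y _; rewrite lee_fin.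
  - by apply: emeasurable_funD => //; exact: measurable_layers.
  move=> y _ /=; rewrite -EFinD lee_fin -lerBlDr.
  apply: (@layers_ge _ _ _ (fun i => y \in U i)); rewrite ?(ltW d0) ?NdM//.
  move=> i ir; rewrite inE /U/=; apply: lt_le_trans (fg y).
  by rewrite lte_fin.
have UL : (\sum_(i < N) fine (nu (U i)) <= \sum_(i < N) fine (nu (L i)) +
    N%:R * (e / M))%R.
  have -> : (N%:R * (e / M) = \sum_(i < N) (e / M))%R.
    by rewrite sumr_const card_ord mulr_natl.
  rewrite -big_split/=; apply: ler_sum => i _.
  by rewrite -lerBlDr ltW// -lte_fin -nuE//; have [] := LP i.
rewrite (eq_bigr (fun i : 'I_N => (fine (nu (L i)))%:E)); last first.
  by move=> i _; rewrite -nuE.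
rewrite sumEFin -EFinM lte_fin.
have : (d * (N%:R * (e / M)) = e)%R.
  by rewrite mulrCA mulrA NdM mulrC divfK// gt_eqF.
move: (ler_wpM2l (ltW d0) UL); rewrite mulrDr.
have : (fine F - t = e + e)%R by rewrite -splitr.
lra.
Qed.

End minorant.

(** * Semicontinuity of the potential and a substitute for Tonelli's theorem *)

Section potential.
Context (R : realType) (X Y : ptopologicalType) (G : X -> Y -> \bar R).
Hypothesis G_ge0 : forall x y, 0 <= G x y.
Hypothesis G_lsc : lower_semicontinuous (fun z : X * Y => G z.1 z.2).
Hypothesis hY : hausdorff_space Y.
Variable nu : {measure set (borelType Y) -> \bar R}.
Hypotheses (nu_fin : nu setT < +oo) (nu_inner : inner_regular_on_open nu).

(** The minorant [h] is a layer sum over compact sets for [G x]. Its finitely many strict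
    inequalities survive near [x] by [lsc_tube], and [layers_le] turns them back into a bound by
    [G x']. *)
Lemma potential_local_minorant (x : X) (t : R) : t%:E < potential G nu x ->
  exists h : Y -> R, [/\ forall y, (0 <= h y)%R,
    measurable_fun [set: borelType Y] (fun y : borelType Y => (h y)%:E),
    t%:E < \int[nu]_(y in [set: borelType Y]) (h y)%:E &
    \forall x' \near x, forall y, (h y)%:E <= G x' y].
Proof.
move=> tG.
have [d [N [L [d0 cL LG tL]]]] :=
  lsc_integral_layers nu_fin nu_inner hY (lsc_snd G_lsc (x := x)) (G_ge0 x) tG.
exists (fun y => d * \sum_(i < N) (y \in L i)%:R)%R; split => //.
- by move=> y; rewrite mulr_ge0 ?(ltW d0)// sumr_ge0.
- by apply: measurable_layers => // i; exact: compact_borel_measurable.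
have : \forall x' \near x, forall i : 'I_N, forall y, L i y ->
    (i.+1%:R * d)%:E < G x' y.
  by apply: filter_forall => i; apply: lsc_tube => // y /LG.
apply: filterS => x' LG' y.
(* The test [i < N] is built into the layers because [layers_le] quantifies over all indices,
   whereas only the first [N] inequalities are known near [x]. *)
rewrite (eq_bigr (fun i : 'I_N => ((i < N)%N && (y \in L i))%:R)%R); last first.
  by move=> i _; rewrite ltn_ord.
apply: (@layers_le _ _ _ (fun i => (i < N)%N && (y \in L i))) => //.
  exact: ltW.
by move=> i /andP[iN /set_mem Liy]; exact: (LG' (Ordinal iN)).
Qed.

Lemma potential_lsc : lower_semicontinuous (potential G nu).
Proof.
move=> x t /potential_local_minorant[h [h0 mh th hG]].
exists [set x' | forall y, (h y)%:E <= G x' y] => // x' hG'.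
apply: lt_le_trans th _; apply: ge0_le_integral => //.
- by move=> y _; rewrite lee_fin.
- by apply: lsc_borel_measurable; exact: lsc_snd.
Qed.

(* Stands in for Tonelli's theorem for [sigma] restricted to [K] and [nu]. *)
Lemma potential_compact_minorant (sigma : {measure set (borelType X) -> \bar R})
    (K : set X) (t : R) : hausdorff_space X -> compact K -> (0 <= t)%R ->
  (forall x, K x -> t%:E < potential G nu x) ->
  exists H : Y -> \bar R, [/\ forall y, 0 <= H y,
    measurable_fun [set: borelType Y] (H : borelType Y -> \bar R),
    t%:E * sigma K <= \int[nu]_(y in [set: borelType Y]) H y &
    forall y, H y <= adjoint_potential G sigma K y].
Proof.
move=> hX cK t0 tK.
have mG y D : measurable_fun D (fun x : borelType X => G x y).
  by apply: measurable_funTS; apply: lsc_borel_measurable; exact: lsc_fst.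
pose Q (E : set X) := exists H : Y -> \bar R, [/\ forall y, 0 <= H y,
    measurable_fun [set: borelType Y] (H : borelType Y -> \bar R),
    t%:E * sigma E <= \int[nu]_(y in [set: borelType Y]) H y &
    forall y, H y <= adjoint_potential G sigma E y].
(* Requiring [Q] for every Borel subset of an open [W] allows a set inside [W]|[W'] to be cut into
   the disjoint pieces [E]&[W] and [E]\[W], whose adjoint potentials add up to that of [E]. *)
pose P (A : set X) := exists W, [/\ open W, A `<=` W &
  forall E : set (borelType X), measurable E -> E `<=` W -> Q E].
suff : P K.
  by move=> [W [_ KW WQ]]; apply: WQ KW; exact: compact_borel_measurable.
apply: compact_ind cK _ _ _ _.
- exists set0; split; [exact: open0| by []|move=> E _]; rewrite subset0 => ->.
  exists (cst 0); split => //.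
    by rewrite measure0 mule0 integral0.
  by move=> y; apply: integral_ge0.
- move=> A B [W [oW AW WQ]] [W' [oW' BW' WQ']].
  exists (W `|` W'); split; [exact: openU|exact: setUSS|move=> E mE EW].
  have mW := open_borel_measurable oW.
  have [|H [H0 mH tH HG]] := WQ (E `&` W) (measurableI _ _ mE mW).
    by move=> x [].
  have [|H' [H'0 mH' tH' HG']] := WQ' (E `\` W) (measurableD mE mW).
    by move=> x [/EW[]].
  have EE : E = E `&` W `|` E `\` W by rewrite setUIDK.
  exists (fun y => H y + H' y); split.
  + by move=> y; rewrite adde_ge0.
  + exact: emeasurable_funD.
  + rewrite ge0_integralD//; apply: le_trans (leeD tH tH').
    rewrite -ge0_muleDr//; apply: lee_wpmul2l; first by rewrite lee_fin.
    by rewrite [in leLHS]EE; apply: measureU2;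
      [exact: measurableI|exact: measurableD].
  + move=> y; apply: le_trans (leeD (HG y) (HG' y)) _.
    rewrite /adjoint_potential -ge0_integral_setU ?setUIDK//.
    * exact: measurableI.
    * exact: measurableD.
    * by apply/disj_set2P/seteqP; split => // z [[_ Wz] [_ /(_ Wz)]].
- by move=> A B BA [W [oW AW WQ]]; exists W; split => // x /BA/AW.
move=> x /tK /potential_local_minorant[h [h0 mh th hG]].
rewrite /prop_near1 nbhsE in hG; have [U xU UG] := hG; exists U => //; exists U.
split => //; first by case: xU.
(* On a small piece [E], the kernel dominates [h] uniformly in the first variable, so the double
   integral reduces to a product. *)
move=> E mE EU; exists (fun y => sigma E * (h y)%:E); split.
- by move=> y; rewrite mule_ge0// lee_fin.
- exact: emeasurable_funM.
- rewrite ge0_integralZl//; last by move=> y _; rewrite lee_fin.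
  by rewrite muleC; apply: lee_wpmul2l => //; exact: ltW.
move=> y; rewrite muleC -(integral_cst sigma mE); apply: ge0_le_integral => //.
- by move=> z _; rewrite lee_fin.
- by move=> z Ez; apply: UG; exact: EU.
Qed.

End potential.

(** * Dirac masses as Radon measures *)

Lemma dirac_radon (R : realType) (T : ptopologicalType) (a : T) :
  hausdorff_space T -> radon_measure
    (\d_(a : borelType T) : {measure set (borelType T) -> \bar R})%R.
Proof.
move=> hT; set mu : {measure set (borelType T) -> \bar R} :=
  \d_(a : borelType T)%R.
have muE A : mu A = ((a \in A)%:R)%:E by [].
have muT : mu setT = 1 by rewrite muE mem_set.
split.
- move=> x; exists setT; first by split => //; exact: openT.
  by rewrite muT ltry.
- move=> A mA; apply/eqP; rewrite eq_le; apply/andP; split.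
    apply: le_ereal_inf_tmp => _ [U [oU AU] <-].
    apply: le_measure => //; rewrite inE //; exact: open_borel_measurable.
  rewrite [leRHS]muE; have [aA|aA] := boolP (a \in A).
    apply: ereal_inf_lbound; exists setT; first by split => //; exact: openT.
    by rewrite muT.
  (* When [a] lies outside [A], the complement of the point is an open superset of mass zero, since
     points are closed. *)
  apply: ereal_inf_lbound; exists (~` [set a]).
    split; last by move=> x Ax xa; move: aA; rewrite -xa mem_set.
    apply: closed_openC; apply: compact_closed => //; exact: compact_set1.
  by rewrite muE memNset// => /(_ erefl).
move=> U oU; apply/eqP; rewrite eq_le; apply/andP; split; last first.
  apply: ge_ereal_sup => _ [K [cK KU] <-].
  apply: le_measure => //; rewrite inE; first exact: compact_borel_measurable.
  exact: open_borel_measurable.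
rewrite [leLHS]muE; have [aU|aU] := boolP (a \in U).
  apply: ereal_sup_ubound; exists [set a].
    by split; [exact: compact_set1|move=> _ ->; exact: set_mem].
  by rewrite muE mem_set.
apply: ereal_sup_ubound; exists set0; first by split => //; exact: compact0.
by rewrite measure0.
Qed.

(** * Weak-type bounds from compact subsets *)

Lemma weak_type_inner (R : realType) (T : ptopologicalType)
    (mu : {measure set (borelType T) -> \bar R}) (q t B : R) (E : set T) :
  hausdorff_space T -> locally_finite_measure mu -> inner_regular_on_open mu ->
  (0 < q)%R -> (0 < t)%R -> (0 <= B)%R -> open E ->
  (forall K : set T, compact K -> K `<=` E ->
    t%:E * mu K <= B%:E * mu K `^ (1 - q^-1)) ->
  t%:E * mu E `^ q^-1 <= B%:E.
Proof.
move=> hT mu_lf mu_inner q0 t0 B0 oE KB.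
suff muE : mu E <= ((B / t) `^ q)%:E.
  rewrite muleC -lee_pdivlMr//.
  apply: (@le_trans _ _ (((B / t) `^ q)%:E `^ q^-1)).
    apply: gt0_ler_poweR => //;
      rewrite ?invr_ge0 ?(ltW q0)// in_itv/= leey andbT//.
    by rewrite lee_fin powR_ge0.
  rewrite poweR_EFin -powRrM divff ?gt_eqF// powRr1 ?divr_ge0 ?(ltW t0)//.
rewrite mu_inner//; apply: ge_ereal_sup => _ [K [cK KE] <-].
have := KB K cK KE; have := locally_finite_compact mu_lf hT cK.
have : 0 <= mu K by exact: measure_ge0.
case: (mu K) => [s| |]; [rewrite lee_fin => s0 _|by rewrite ltxx|by []].
rewrite poweR_EFin -!EFinM !lee_fin.
have [->|sN0] := eqVneq s 0%R; first by rewrite powR_ge0.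
have s_gt0 : (0 < s)%R by rewrite lt0r sN0.
rewrite powRD; last by rewrite (gt_eqF s_gt0) implybT.
rewrite powRr1 ?(ltW s_gt0)// powRN => tsB.
have sq0 : (0 < s `^ q^-1)%R by rewrite powR_gt0.
have : (s `^ q^-1 <= B / t)%R.
  rewrite ler_pdivlMr//; move: tsB; rewrite mulrCA mulrC ler_pM2l//.
  by rewrite ler_pdivlMr// mulrC.
move/(@ge0_ler_powR _ q (ltW q0)) => /(_ (ltW sq0)).
rewrite nnegrE divr_ge0 ?(ltW t0)// => /(_ isT).
by rewrite -powRrM mulVf ?gt_eqF// powRr1// ltW.
Qed.

(** * From level-set bounds to integrals by dyadic layers *)

Lemma poweR_inv_le (R : realType) (x : \bar R) (q y : R) :
  (0 < q)%R -> (0 <= y)%R -> 0 <= x -> x `^ q^-1 <= y%:E ->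
  x <= (y `^ q)%:E.
Proof.
move=> q0 y0 x0 xy.
rewrite -[x]poweRe1// -[1%R in leLHS](mulVf (lt0r_neq0 q0)) poweRrM.
rewrite -poweR_EFin; apply: gt0_ler_poweR => //; first exact: ltW.
- by rewrite in_itv/= poweR_ge0 leey.
- by rewrite in_itv/= lee_fin y0 leey.
Qed.

Lemma dyadic_layers_ge (R : realType) (s : R) (y : \bar R) :
  (0 < s)%R ->
  y <= s%:E + \sum_(k <oo) (s * 2 ^+ k * ((s * 2 ^+ k)%:E < y)%E%:R)%:E.
Proof.
move=> s0.
pose u k := (s * 2 ^+ k * ((s * 2 ^+ k)%:E < y)%E%:R)%:E.
have u0 k : 0 <= u k by rewrite lee_fin mulr_ge0// mulr_ge0 ?(ltW s0).
pose S n := (\sum_(0 <= k < n) (s * 2 ^+ k * ((s * 2 ^+ k)%:E < y)%E%:R))%R.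
have SE n : (s + S n)%:E <= s%:E + \sum_(k <oo) u k.
  rewrite EFinD /S -sumEFin leeD2l//.
  exact: (nneseries_lim_ge n (fun k _ _ => u0 k)).
(* As long as every level is exceeded, the geometric sum gives [s + S n = s * 2 ^+ n]; the first
   level not exceeded then bounds [y]. *)
have yS n : y <= (s + S n)%:E \/ (s + S n = s * 2 ^+ n)%R.
  elim: n => [|n IH].
    by right; rewrite /S big_geq// addr0 expr0 mulr1.
  rewrite /S big_nat_recr//= -/(S n).
  case: (ltP (s * 2 ^+ n)%:E y) => [_|yn].
    rewrite mulr1; case: IH => [yS|SnE]; [left|right].
      apply: le_trans yS _; rewrite lee_fin lerD2l lerDl mulr_ge0 ?(ltW s0)//.
    by rewrite addrA SnE exprS; ring.
  rewrite mulr0 addr0; left; case: IH => // ->//.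
have [[n yn]|nyS] := pselect (exists n, y <= (s + S n)%:E).
  exact: le_trans yn (SE n).
suff -> : s%:E + \sum_(k <oo) u k = +oo by rewrite leey.
(* If [y] is never reached, the partial sums are [s * 2 ^+ n] for every [n], so the series
   diverges. *)
apply/eq_infty => a; pose n := (Num.truncn (a / s)).+1.
apply: le_trans (SE n).
have [ySn|->] := yS n; first by exfalso; apply: nyS; exists n.
rewrite lee_fin mulrC -ler_pdivrMr//; apply/ltW/(lt_trans (truncnS_gt _)).
by rewrite -natrX ltr_nat ltn_expl.
Qed.

Lemma powR2_lt1 (R : realType) (q : R) : (1 < q)%R -> (2 `^ (1 - q) < 1 :> R)%R.
Proof.
move=> q1; rewrite -opprB powRN invf_lt1 ?powR_gt0//.
have := @gt0_ltr_powR R (q - 1) _ 1%R 2%R; rewrite powR1; apply;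
  by rewrite ?subr_gt0 ?nnegrE ?ltr1n.
Qed.

Lemma weak_Lnorm_const_gt0 (R : realType) (A q : R) :
  (1 < q)%R -> (0 < 1 + A `^ q / (1 - 2 `^ (1 - q)))%R.
Proof.
move=> /powR2_lt1 r1.
by rewrite ltr_pwDl// divr_ge0 ?powR_ge0// subr_ge0 ltW.
Qed.

Lemma integral_le_weak_Lnorm (d : measure_display) (T : measurableType d)
    (R : realType) (mu : {measure set T -> \bar R}) (q A : R)
    (f : T -> \bar R) (E : set T) :
  (1 < q)%R -> (0 <= A)%R -> (forall x, 0 <= f x) ->
  measurable_fun setT f -> measurable E -> weak_Lnorm mu q f <= A%:E ->
  \int[mu]_(x in E) f x <=
    (1 + A `^ q / (1 - 2 `^ (1 - q)))%:E * mu E `^ (1 - q^-1).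
Proof.
move=> q1 A0 f0 mf mE fA.
have q0 : (0 < q)%R by apply: lt_trans q1.
have qV : (0 < 1 - q^-1)%R by rewrite subr_gt0 invf_lt1.
have r1 := powR2_lt1 q1; have C1 := weak_Lnorm_const_gt0 A q1.
set r := (2 `^ (1 - q))%R in r1 C1 *.
have r0 : (0 < r)%R by rewrite powR_gt0.
have flevel u : (0 < u)%R ->
    mu [set x | u%:E < f x] <= (A `^ q * u `^ (- q))%:E.
  move=> u0.
  have : u%:E * mu [set x | u%:E < f x] `^ q^-1 <= A%:E.
    apply: le_trans fA; apply: ereal_sup_ubound; exists u => //.
    by under eq_set do rewrite gee0_abs//.
  rewrite muleC -lee_pdivlMr// -EFinM => /poweR_inv_le.
  move=> /(_ q0 (divr_ge0 A0 (ltW u0)) (measure_ge0 _ _)).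
  rewrite powRM ?invr_ge0 ?(ltW u0)//.
  by rewrite -(powR_inv1 (ltW u0)) -powRrM mulN1r.
(* Measures zero and infinity are set aside, as the choice of [s] below needs a positive real: in
   the first case the integral vanishes, in the second the right-hand side is infinite. *)
have [mE0|mE0] := eqVneq (mu E) 0.
  rewrite null_set_integral//; last exact: measurable_funTS.
  by rewrite mule_ge0 ?poweR_ge0// lee_fin ltW.
have [->|mEy] := eqVneq (mu E) +oo.
  by rewrite poweRyr ?(gt_eqF qV)// gt0_muley ?leey.
have : 0 <= mu E by exact: measure_ge0.
case EM : (mu E) mE0 mEy => [m| |]//; rewrite lee_fin => m0 _ mge0.
have {m0 mge0} m0 : (0 < m)%R by rewrite lt0r -eqe m0.
(* This value balances the two contributions: [s * m] and [s]^ (1 - q)[both equal]m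
   [^ (1 - q^-1)]. *)
pose s := (m `^ (- q^-1))%R.
have s0 : (0 < s)%R by rewrite powR_gt0.
have mU (k : nat) : measurable [set x | (s * 2 ^+ k)%:E < f x].
  by rewrite -[X in measurable X]setTI; exact: emeasurable_fun_o_infty.
pose g k x := (s * 2 ^+ k * ((s * 2 ^+ k)%:E < f x)%E%:R)%:E.
have g0 k x : 0 <= g k x by rewrite lee_fin mulr_ge0// mulr_ge0// ltW.
have gE k : g k =
    fun x => (s * 2 ^+ k)%:E * (\1_[set x | ((s * 2 ^+ k)%:E < f x)%E] x)%:E.
  apply/funext => x; rewrite /g -EFinM indicE.
  congr (_ * (nat_of_bool _)%:R)%:E.
  by apply/idP/idP => [?|/set_mem//]; rewrite mem_set.
have mg k : measurable_fun E (g k).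
  rewrite gE; apply: emeasurable_funM => //.
  by apply/measurable_EFinP; exact: measurable_indic.
have intg k : \int[mu]_(x in E) g k x <= (A `^ q * s `^ (1 - q) * r ^+ k)%:E.
  rewrite gE ge0_integralZl//; last 2 first.
  - by apply/measurable_EFinP; exact: measurable_indic.
  - by rewrite lee_fin mulr_ge0// ltW.
  rewrite integral_indic//.
  have u0 : (0 < s * 2 ^+ k)%R by rewrite mulr_gt0// exprn_gt0.
  apply: (@le_trans _ _ ((s * 2 ^+ k)%:E *
      (A `^ q * (s * 2 ^+ k) `^ (- q))%:E)).
    apply: lee_wpmul2l; first by rewrite lee_fin ltW.
    apply: le_trans (flevel _ u0); apply: le_measure; rewrite ?inE//.
    exact: measurableI.
  rewrite -EFinM lee_fin mulrCA -{1}(@powRr1 _ (s * 2 ^+ k)) ?(ltW u0)//.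
  rewrite -powRD; last by rewrite (gt_eqF u0) implybT.
  rewrite powRM ?(ltW s0)// mulrA -powR_mulrn// -powR_mulrn ?(ltW r0)//.
  by rewrite -!powRrM [(k%:R * _)%R]mulrC.
have sm : (s * m = m `^ (1 - q^-1))%R.
  rewrite powRD; last by rewrite (gt_eqF m0) implybT.
  by rewrite powRr1 ?(ltW m0)// mulrC.
have sq : (s `^ (1 - q) = m `^ (1 - q^-1))%R.
  by rewrite -powRrM; congr (_ `^ _)%R; field; rewrite gt_eqF.
apply: (@le_trans _ _ (\int[mu]_(x in E) (cst s%:E x + \sum_(k <oo) g k x))).
  apply: ge0_le_integral => //.
  - exact: measurable_funTS.
  - by apply: emeasurable_funD => //; exact: ge0_emeasurable_sum.
  - by move=> x _; exact: dyadic_layers_ge.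
rewrite ge0_integralD//; last 3 first.
- by move=> x _; rewrite lee_fin ltW.
- by move=> x _; exact: nneseries_ge0.
- exact: ge0_emeasurable_sum.
rewrite integral_cst// EM integral_nneseries//.
rewrite poweR_EFin -!EFinM sm mulrDl mul1r EFinD leeD2l//.
apply: lime_le; first by apply: is_cvg_nneseries => k _ _; exact: integral_ge0.
near=> n.
apply: (@le_trans _ _ (\sum_(0 <= k < n) (A `^ q * s `^ (1 - q) * r ^+ k)%:E)).
  exact: lee_sum.
rewrite sumEFin lee_fin.
have -> : (\sum_(0 <= k < n) A `^ q * s `^ (1 - q) * r ^+ k =
    series (geometric (A `^ q * s `^ (1 - q)) r) n)%R by [].
rewrite geometric_seriesE ?lt_eqF//= sq [leRHS]mulrAC.
rewrite ler_pM2r ?invr_gt0 ?subr_gt0//.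
by rewrite ler_piMr// ?mulr_ge0 ?powR_ge0// gerBl exprn_ge0// ltW.
Unshelve. all: by end_near.
Qed.

(** * The cycle (1) => (2) => (3) => (1), closing the equivalences *)

Theorem proposition6p2 (R : realType) (X Y : ptopologicalType)
    (lcX : locally_compact [set: X]) (hX : hausdorff_space X)
    (lcY : locally_compact [set: Y]) (hY : hausdorff_space Y)
    (G : X -> Y -> \bar R)
    (G_ge0 : forall x y, 0 <= G x y)
    (G_lsc : lower_semicontinuous (fun z : X * Y => G z.1 z.2))
    (q q' : R) (q_gt1 : (1 < q)%R) (qq' : (1 / q + 1 / q' = 1)%R)
    (sigma : {measure set (borelType X) -> \bar R})
    (sigma_radon : radon_measure sigma) :
  let statement1 :=
    exists2 C : R, (0 < C)%R &
      forall nu : {measure set (borelType Y) -> \bar R}, radon_measure nu ->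
        weak_Lnorm sigma q (potential G nu) <= C%:E * nu [set: Y] in
  let statement2 :=
    ereal_sup (range (fun y : Y => weak_Lnorm sigma q (fun x => G x y)))
      < +oo in
  let statement3 :=
    exists2 C : R, (0 < C)%R &
      forall E : set (borelType X), measurable E ->
        ereal_sup (range (adjoint_potential G sigma E))
          <= C%:E * sigma E `^ (1 / q') in
  (statement1 <-> statement2) /\ (statement2 <-> statement3).
Proof.
move=> S1 S2 S3.
have q0 : (0 < q)%R by apply: lt_trans q_gt1.
have q'E : (1 / q' = 1 - q^-1)%R 
  by move: qq'; rewrite !div1r => <-; rewrite addrAC subrr add0r.
have [sigma_lf _ sigma_inner] := sigma_radon.
have mG y : measurable_fun setT (fun x : borelType X => G x y).
  by apply: lsc_borel_measurable; exact: lsc_fst.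
have S12 : S1 -> S2.
  move=> [C C0 HC]; apply: (@le_lt_trans _ _ C%:E); last exact: ltry.
  apply: ge_ereal_sup => _ [y _ <-].
  have := HC _ (dirac_radon R y hY).
  rewrite [X in _ * X](_ : _ = 1) ?mule1; last first.
    by rewrite /= diracE mem_set.
  suff -> : potential G (\d_(y : borelType Y))%R = G^~ y by [].
  apply/funext => x; rewrite /potential integral_dirac//.
    by rewrite diracE mem_set// mul1e.
  by apply: lsc_borel_measurable; exact: lsc_snd.
have S23 : S2 -> S3.
  move=> Sfin; have [A A0 GA] : exists2 A : R, (0 <= A)%R &
      forall y, weak_Lnorm sigma q (G^~ y) <= A%:E.
    have GS y : weak_Lnorm sigma q (G^~ y) <=
        ereal_sup (range (fun y : Y => weak_Lnorm sigma q (fun x => G x y))).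
      by apply: ereal_sup_ubound; exists y.
    move: Sfin GS; rewrite /S2; case: ereal_sup => [A _ GA| |_ GA].
    (* The absolute value supplies nonnegativity without a separate argument about the sign of the
       supremum. *)
    - exists `|A|%R => // y; apply: le_trans (GA y) _.
      by rewrite lee_fin ler_norm.
    - by rewrite ltxx.
    - by exists 0%R => // y; apply: le_trans (GA y) _; rewrite leNye.
  exists (1 + A `^ q / (1 - 2 `^ (1 - q)))%R.
    exact: weak_Lnorm_const_gt0.
  move=> E mE; apply: ge_ereal_sup => _ [y _ <-].
  by rewrite q'E; exact: integral_le_weak_Lnorm.
have S31 : S3 -> S1.
  move=> [C C0 HC]; exists C => // nu [_ _ nu_inner].
  (* For infinite [nu] the bound is trivial because [C] is positive; the lemmas on potentials
     require finite [nu]. *)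
  have [nuy|] := eqVneq (nu setT) +oo; first by rewrite nuy gt0_muley ?leey.
  rewrite -ltey => nu_fin.
  have nuE : nu setT = (fine (nu setT))%:E.
    by rewrite fineK// ge0_fin_numE.
  apply: ge_ereal_sup => _ [t /= t0 <-].
  rewrite nuE -EFinM.
  rewrite (_ : [set x | _] = [set x | t%:E < potential G nu x]); last first.
    by apply/seteqP; split => x /=; rewrite gee0_abs//; exact: integral_ge0.
  apply: weak_type_inner => //.
  - by rewrite mulr_ge0 ?(ltW C0)// fine_ge0.
  - have /lower_semicontinuousP := potential_lsc G_ge0 G_lsc hY nu_fin nu_inner.
    exact.
  move=> K cK KE.
  have mK := compact_borel_measurable hX cK.
  have [H [H0 mH tH HG]] := potential_compact_minorant G_ge0 G_lsc hY nu_fin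
    nu_inner sigma hX cK (ltW t0) KE.
  apply: (le_trans tH).
  (* Statement (3) for [K] bounds [H] by a constant, whose [nu]-integral has the form asked by
     [weak_type_inner] with [B] equal to [C] times the mass of [nu]. *)
  apply: (@le_trans _ _ (\int[nu]_(y in [set: borelType Y])
      cst (C%:E * sigma K `^ (1 - q^-1)) y)).
    apply: ge0_le_integral => // y _.
    apply: le_trans (HG y) _; rewrite -q'E; apply: le_trans (HC K mK).
    by apply: ereal_sup_ubound; exists y.
  by rewrite integral_cst// nuE EFinM muleAC.
tauto.
Qed.
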